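(* Let $F$ be a field containing a primitive third root of unity $\rho$, let $A$ be a central simple $F$-algebra, and let $B=\{x_1,\dots,x_n\}\subseteq A$ be a coherent $3$-central set with associated directed graph $(B,E_B)$. Let $(x_i,x_j,x_k)$ be a cycle in $(B,E_B)$. Then for every $x_l\in B$ outside this cycle, either $(x_l,x_i),(x_l,x_j),(x_l,x_k)\in E_B$ or $(x_i,x_l),(x_j,x_l),(x_k,x_l)\in E_B$.
   Context: A finite set $B=\{x_1,\dots,x_n\}$ of invertible elements of $A$ is a $3$-central set if $x_k^3\in F$ for every $k$ and for all $i,j$ there is $c_{i,j}\in\mathbb{Z}/3\mathbb{Z}$ with $x_ix_j=\rho^{c_{i,j}}x_jx_i$. An $F$-subspace $V\subseteq A$ is $3$-central if $v^3\in F$ for every $v\in V$. A $3$-central set is coherent if its elements are linearly independent over $F$ and span a $3$-central space (i.e. it is a basis of a $3$-central space); in such a set no two distinct elements commute. The directed graph $(B,E_B)$ has vertex set $B$ and $(x_i,x_j)\in E_B$ if and only if $x_ix_j=\rho x_jx_i$ (i.e. $c_{i,j}=1$). A cycle is a sequence of vertices $a_1,\dots,a_r$ without repetitions such that $(a_1,a_2),\dots,(a_{r-1},a_r),(a_r,a_1)$ are all edges. *)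

(* Defs.v *)
From mathcomp Require Import all_boot all_order all_algebra all_field.

Set Implicit Arguments.
Unset Strict Implicit.
Unset Printing Implicit Defensive.

Import GRing.Theory.
Local Open Scope ring_scope.

(* A [falgType F] is a nonzero finite-dimensional unital F-algebra, and 1%VS
   is the copy F.1 of F inside it. A two-sided ideal I of such an algebra is
   always an F-subspace, since a *: v = (a *: 1) * v, so ideals are rendered
   as [{vspace A}] without loss of generality. *)
Definition two_sided_ideal (F : fieldType) (A : falgType F)
    (I : {vspace A}) : Prop :=
  forall a u : A, u \in I -> a * u \in I /\ u * a \in I.

Definition central_simple (F : fieldType) (A : falgType F) : Prop :=
  'Z({:A})%VS = 1%VS /\
  (forall I : {vspace A}, two_sided_ideal I -> I = 0%VS \/ I = fullv).

(* A finite set {x_1, ..., x_n} is given by its duplicate-free list of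
   elements. *)
Definition three_central_set (F : fieldType) (A : falgType F) (rho : F)
    (B : seq A) : Prop :=
  [/\ uniq B,
      forall x, x \in B -> x \is a GRing.unit,
      forall x, x \in B -> x ^+ 3 \in 1%VS &
      forall x y, x \in B -> y \in B ->
        exists c : 'Z_3, x * y = rho ^+ c *: (y * x)].

Definition three_central_space (F : fieldType) (A : falgType F)
    (V : {vspace A}) : Prop :=
  forall v, v \in V -> v ^+ 3 \in 1%VS.

Definition coherent (F : fieldType) (A : falgType F) (rho : F)
    (B : seq A) : Prop :=
  [/\ three_central_set rho B, free B & three_central_space <<B>>%VS].

(* The edge relation E_B of the directed graph (B, E_B); its cycles, in the
   sense of sequences of distinct vertices, are the [ucycle]s of the path
   library. *)
Definition edge (F : fieldType) (A : falgType F) (rho : F) (B : seq A) :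
    rel A :=
  [rel x y | [&& x \in B, y \in B & x * y == rho *: (y * x)]].

(* Main.v *)
Require Import Defs.
From mathcomp Require Import all_boot all_order all_algebra all_field.
From mathcomp Require Import ring.

Set Implicit Arguments.
Unset Strict Implicit.
Unset Printing Implicit Defensive.

Import GRing.Theory.
Local Open Scope ring_scope.

(** Cubing maps the span V of B into F, so each polarization of the cubic form
    v |-> v^3 also has its values in F.

    Two consequences carry the proof. If x and y in B commute, polarization
    gives 3 x^2 y in F, and 3 is invertible because F has a primitive cube root
    of unity; as x^3 is a nonzero scalar, y is then a multiple of x, so that
    y = x by linear independence ([coherent_comm_eq]). Hence any two distinct
    elements of B are joined by an edge, in one direction or the other
    ([coherent_edge]).
    For a cycle x -> y -> z -> x, the three even rearrangements of xyz are equal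
    to xyz, and the three odd ones to rho^2 xyz, so that their sum is
    3 (1 + rho^2) xyz = - 3 rho xyz; since this lies in F, so does xyz
    ([cycle_prod_scalar]).

    Now take a fourth element w. It commutes with the scalar xyz. On the other
    hand, moving w across x, y and z produces the factors rho^a, rho^b and
    rho^c, with a, b and c in {1, 2}. So 3 divides a + b + c, and this forces
    a = b = c: the edges between w and the cycle all point the same way. *)

Lemma prim_root3_sum (F : fieldType) (rho : F) :
  3.-primitive_root rho -> 1 + rho + rho ^+ 2 = 0.
Proof.
move=> rho_prim; have rho3 := prim_expr_order rho_prim.
have rho1 : rho - 1 != 0.
  by rewrite subr_eq0 -[rho]expr1 -[1](prim_expr_order rho_prim)
             (eq_prim_root_expr rho_prim).
apply: (mulfI rho1); rewrite mulr0.
by transitivity (rho ^+ 3 - 1); [ring | rewrite rho3 subrr].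
Qed.

Section Algebra.

Variables (F : fieldType) (A : falgType F).
Implicit Types (rho : F) (u v x y z : A) (V : {vspace A}) (B : seq A).

(** The component of degree 2 in u and 1 in v of (u + v)^3. *)
Definition polar21 u v := u * u * v + u * v * u + v * u * u.

Lemma cube_addZ u v (a : F) :
  (u + a *: v) ^+ 3 =
  u ^+ 3 + a *: polar21 u v + a ^+ 2 *: polar21 v u + a ^+ 3 *: v ^+ 3.
Proof.
rewrite /polar21 !exprS !expr0 !mulr1 !mulrDl !mulrDr.
rewrite -!scalerAl -!scalerAr !scalerDr !scalerA !mulrA.
by rewrite !addrA [LHS](ACl (1*2*3*5*7*6*4*8)%AC).
Qed.

(** Replacing v by rho v scales the two mixed components of (u + v)^3 by the
    different factors rho and rho^2, so each of them is a combination of cubes.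
    Scaling by rho rather than by integers keeps this valid in characteristic 2
    and over a field with only four elements. *)
Lemma polar21_mem rho V u v : 3.-primitive_root rho ->
  three_central_space V -> u \in V -> v \in V -> polar21 u v \in 1%VS.
Proof.
move=> rho_prim V3 uV vV.
have PQ (a : F) : a *: polar21 u v + a ^+ 2 *: polar21 v u \in 1%VS.
  have := V3 (u + a *: v) (rpredD uV (rpredZ _ vV)).
  rewrite cube_addZ rpredDr ?rpredZ ?V3 // -addrA.
  by rewrite rpredDl ?V3.
have ne : rho - rho ^+ 2 != 0.
  rewrite subr_eq0 -{1}[rho]expr1 (eq_prim_root_expr rho_prim) //.
move: (polar21 u v) (polar21 v u) PQ => P Q PQ.
suff: (rho - rho ^+ 2) *: P \in 1%VS.
  by move/(rpredZ (rho - rho ^+ 2)^-1); rewrite scalerA mulVf // scale1r.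
have := rpredB (PQ rho) (rpredZ (rho ^+ 2) (PQ 1)).
by rewrite expr1n !scale1r scalerDr opprD addrACA subrr addr0 -scalerBl.
Qed.

(** The full polarization of the cube is the polarization in u, at x and y, of
    the quadratic map u |-> [polar21 u z]. *)
Lemma polarization_mem rho V x y z : 3.-primitive_root rho ->
  three_central_space V -> x \in V -> y \in V -> z \in V ->
  x * y * z + y * z * x + z * x * y + (y * x * z + x * z * y + z * y * x)
    \in 1%VS.
Proof.
move=> rho_prim V3 xV yV zV.
have mem u v : u \in V -> v \in V -> polar21 u v \in 1%VS.
  exact: polar21_mem rho_prim V3.
have := mem _ _ (rpredD xV yV) zV.
suff -> : polar21 (x + y) z = polar21 x z + polar21 y z +
  (x * y * z + y * z * x + z * x * y + (y * x * z + x * z * y + z * y * x)).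
  by rewrite rpredDl // rpredD ?mem.
rewrite /polar21 !mulrDl !mulrDr !mulrDl !addrA.
by rewrite [LHS](ACl (1*5*9*4*8*12*2*7*11*3*6*10)%AC).
Qed.

Lemma qcomm_mul (a b : F) x y z :
  z * x = a *: (x * z) -> z * y = b *: (y * z) ->
  z * (x * y) = (a * b) *: (x * y * z).
Proof.
by move=> zx zy; rewrite mulrA zx -scalerAl -[x * z * y]mulrA zy -scalerAr scalerA mulrA.
Qed.

(** In a 3-cycle each variable meets the other two with inverse factors, which
    makes the product invariant under cyclic rotation, while a transposition
    costs rho^2. The six terms of the polarization therefore add up to a nonzero
    multiple of one product. *)
Lemma cycle_prod_scalar rho V x y z : 3.-primitive_root rho ->
  three_central_space V -> x \in V -> y \in V -> z \in V ->
  x * y = rho *: (y * x) -> y * z = rho *: (z * y) -> z * x = rho *: (x * z) ->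
  x * y * z \in 1%VS.
Proof.
move=> rho_prim V3 xV yV zV xy yz zx.
have rho3 := prim_expr_order rho_prim.
have rho_inv u v : u * v = rho *: (v * u) -> v * u = rho ^+ 2 *: (u * v).
  by move=> ->; rewrite scalerA -exprSr rho3 scale1r.
have yx := rho_inv _ _ xy; have zy := rho_inv _ _ yz.
have xz := rho_inv _ _ zx.
have yzx : y * z * x = x * y * z.
  by rewrite -[RHS]mulrA (qcomm_mul xy xz) -exprS rho3 scale1r.
have zxy : z * x * y = x * y * z.
  by rewrite -[LHS]mulrA (qcomm_mul zx zy) -exprS rho3 scale1r.
have yxz : y * x * z = rho ^+ 2 *: (x * y * z) by rewrite yx -scalerAl.
have xzy : x * z * y = rho ^+ 2 *: (x * y * z).
  by rewrite -mulrA zy -scalerAr mulrA.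
have zyx : z * y * x = rho ^+ 2 *: (x * y * z) by rewrite zy -scalerAl yzx.
have := polarization_mem rho_prim V3 xV yV zV.
rewrite yzx zxy yxz xzy zyx.
move: (x * y * z) => m.
have -> : m + m + m + (rho ^+ 2 *: m + rho ^+ 2 *: m + rho ^+ 2 *: m)
    = (- (3%:R * rho)) *: m.
  rewrite -[in LHS](scale1r m) !scalerA -!scalerDl; congr (_ *: _).
  (* 1 + rho^2 = - rho, from the vanishing of 1 + rho + rho^2 *)
  have -> : - (3%:R * rho) = 3%:R * (1 + rho ^+ 2) - 3%:R * (1 + rho + rho ^+ 2).
    by ring.
  by rewrite prim_root3_sum //; ring.
have c0 : - (3%:R * rho) != 0.
  by rewrite oppr_eq0 mulf_neq0 ?(prim_root_natf_neq0 rho_prim) //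
             (prim_root_eq0 rho_prim).
by move/(rpredZ (- (3%:R * rho))^-1); rewrite scalerA mulVf // scale1r.
Qed.

(** For commuting x and y, [polar21 x y] is 3 x^2 y. Once x^2 y is a scalar,
    multiplying it by x compares x with x^3 y, a nonzero multiple of y. *)
Lemma coherent_comm_eq rho B x y : 3.-primitive_root rho -> coherent rho B ->
  x \in B -> y \in B -> x * y = y * x -> x = y.
Proof.
move=> rho_prim [[B_uniq B_unit B3 _] B_free V3] xB yB xy.
have xV := memv_span xB; have yV := memv_span yB.
have := polar21_mem rho_prim V3 xV yV.
have -> : polar21 x y = 3%:R *: (x * x * y).
  rewrite /polar21 -xy -[x * y * x]mulrA -xy [x * (x * y)]mulrA.
  by rewrite scaler_nat !mulrS mulr0n addr0 addrA.
move/(rpredZ 3%:R^-1); rewrite scalerA mulVf ?(prim_root_natf_neq0 rho_prim) //.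
rewrite scale1r => /vlineP[k xxy].
have /vlineP[e x3] := B3 x xB.
have e0 : e != 0.
  apply/eqP => e0; have := unitrX 3 (B_unit x xB).
  by rewrite x3 e0 scale0r unitr0.
have y_line : y \in <[x]>%VS.
  apply/vlineP; exists (e^-1 * k).
  have : x ^+ 3 * y = k *: x.
    by rewrite !exprS mulr1 -mulrA xxy -scalerAr mulr1.
  rewrite x3 -scalerAl mul1r => /(congr1 ( *:%R e^-1)).
  by rewrite !scalerA mulVf // scale1r.
apply/eqP; apply: contraTT B_free => x_ne_y.
rewrite (perm_free (perm_to_rem yB)) free_cons negb_and negbK.
apply/orP; left; apply: subvP y_line.
by rewrite -memvE memv_span // (mem_rem_uniq _ B_uniq) inE x_ne_y.
Qed.

(** The boolean c keeps the exponent of rho, c.+1, within {1, 2}, so that the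
    final argument on exponents is a finite case analysis. *)
Lemma coherent_edge rho B x y : 3.-primitive_root rho -> coherent rho B ->
  x \in B -> y \in B -> x != y ->
  exists2 c : bool, x * y = rho ^+ c.+1 *: (y * x) &
    if c then edge rho B y x else edge rho B x y.
Proof.
move=> rho_prim B_coh xB yB x_ne_y; case: (B_coh) => -[_ _ _ B_comm] _ _.
have [[[|[|[|//]]] c_lt] xy] := B_comm x y xB yB; rewrite /= in xy.
- move: xy; rewrite expr0 scale1r => /(coherent_comm_eq rho_prim B_coh xB yB) x_eq_y.
  by rewrite x_eq_y eqxx in x_ne_y.
- by exists false => //; rewrite /edge /= xB yB xy expr1 eqxx.
exists true => //; rewrite /edge /= xB yB xy scalerA -exprS.
by rewrite (prim_expr_order rho_prim) scale1r eqxx.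
Qed.

End Algebra.

Theorem proposition3p2 (F : fieldType) (rho : F)
    (rho_prim : 3.-primitive_root rho)
    (A : falgType F) (A_cs : central_simple A)
    (B : seq A) (B_coh : coherent rho B)
    (xi xj xk : A) (cyc : ucycle (edge rho B) [:: xi; xj; xk])
    (xl : A) (xl_B : xl \in B) (xl_out : xl \notin [:: xi; xj; xk]) :
  [/\ edge rho B xl xi, edge rho B xl xj & edge rho B xl xk] \/
  [/\ edge rho B xi xl, edge rho B xj xl & edge rho B xk xl].
Proof.
case/andP: cyc => /= /and4P[]; rewrite andbT.
move=> /and3P[iB jB /eqP ij] /and3P[_ kB /eqP jk] /and3P[_ _ /eqP ki] _.
case: (B_coh) => -[_ B_unit _ _] _ V3.
have /vlineP[d m_scalar] :=
  cycle_prod_scalar rho_prim V3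
    (memv_span iB) (memv_span jB) (memv_span kB) ij jk ki.
have m_unit : xl * (xi * xj * xk) \is a GRing.unit by rewrite !unitrMr ?B_unit.
move: xl_out; rewrite !inE !negb_or => /and3P[li lj lk].
have [a la ea] := coherent_edge rho_prim B_coh xl_B iB li.
have [b lb eb] := coherent_edge rho_prim B_coh xl_B jB lj.
have [c lc ec] := coherent_edge rho_prim B_coh xl_B kB lk.
(* The factors collected on the way give xl m = rho^(a + b + c + 3) m xl for
   m = xi xj xk, while m is a scalar: 3 divides the exponent. *)
have lab : xl * (xi * xj) = rho ^+ (a.+1 + b.+1) *: (xi * xj * xl).
  by rewrite (qcomm_mul la lb) -exprD.
have := qcomm_mul lab lc; rewrite -exprD.
have -> : xi * xj * xk * xl = xl * (xi * xj * xk).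
  by rewrite m_scalar -scalerAl -scalerAr mul1r mulr1.
move: m_unit; move: (xl * _) => m m_unit /eqP.
rewrite -{1}[m]scale1r -subr_eq0 -scalerBl scaler_eq0 subr_eq0.
have /negPf -> : m != 0 by apply: contraTneq m_unit => ->; rewrite unitr0.
rewrite orbF -(expr0 rho) (eq_prim_root_expr rho_prim).
by case: a b c ea eb ec {la lb lc lab} => [] [] [] //=; [right | left].
Qed.
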